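(* Let $p$ be a prime. Suppose that $G$ is a finite solvable group acted on by automorphisms by an elementary abelian $p$-group $A$ with $|A|\geq p^{4}$. If this action is good and $C_G(a)$ is supersolvable for every nontrivial element $a\in A$, then $G$ is supersolvable.
   Context: All groups are finite. If a group $A$ acts on a group $G$ by automorphisms, the action is called good if $H=[H,B]C_H(B)$ for every subgroup $B\le A$ and every $B$-invariant subgroup $H\le G$. *)

(* Defs.v *)
From HB Require Import structures.
From mathcomp Require Import all_boot all_fingroup all_solvable.
Set Implicit Arguments. Unset Strict Implicit. Unset Printing Implicit Defensive.

Local Open Scope group_scope.

Definition supersolvable (gT : finGroupType) (G : {set gT}) : Prop :=
  exists2 s : seq {group gT},
    all (fun H : {group gT} => H <| G) s &
    path (fun H K : {group gT} => (H \subset K) && cyclic (K / H)) 1%G s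
    && (last 1%G s == G :> {set gT}).

Definition actcomm (aT rT : finGroupType) (D : {set aT}) (R : {set rT})
  (to : groupAction D R) (H : {set rT}) (B : {set aT}) : {set rT} :=
  <<[set x^-1 * to x b | x in H, b in B]>>.

Definition good_action (aT rT : finGroupType) (A : {group aT}) (G : {group rT})
  (to : groupAction A G) : Prop :=
  forall (B : {group aT}) (H : {group rT}),
    B \subset A -> H \subset G -> [acts B, on H | to] ->
    H :=: actcomm to H B * 'C_(H | to)(B).

(* Main.v *)
(* Work inside the semidirect product of G by A and induct on |G|: for an
   A-invariant minimal normal subgroup V of G, an elementary abelian q-group,
   G/V is supersolvable, so it suffices to find a G-normal series of V with
   cyclic factors.  A good p-group action centralizes every invariant
   p-subgroup, so if q = p then [G, A] centralizes V, G = [G, A] C_G(A) acts on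
   V through C_G(A), and V lies in the supersolvable group C_G(a).

   If q <> p, put C = C_G(V) and H = G/C, so that O_q(H) = 1 and F(H) is a
   q'-group.  Every A-invariant solvable subgroup is generated by its
   centralizers of subgroups B of A with |A : B| dividing p.  Two such B meet in
   a D of order at least p^2, and V is generated by the C_V(d), d in D nontrivial;
   since C_G(D) lies in each supersolvable group C_G(d), the q'-elements of
   C_G(D)' and the (q-1)-th powers of q'-elements of C_G(D) centralize V.  Hence
   F(H) is central in H, so H = F(H) is abelian, of exponent dividing q-1, and
   all irreducible H-sections of V have order q. *)

Require Import Defs.
From HB Require Import structures.
From mathcomp Require Import all_boot all_fingroup all_solvable.
From mathcomp Require Import all_algebra all_field all_character.
Set Implicit Arguments. Unset Strict Implicit. Unset Printing Implicit Defensive.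

Import GRing.Theory.
Local Open Scope group_scope.

(** * Normal series with cyclic factors *)

Definition cyclic_factor (gT : finGroupType) (H K : {group gT}) : bool :=
  (H \subset K) && cyclic (K / H).

(** Relative form of [supersolvable], which is [cyclic_chain G 1%G G] by conversion; series between
    successive terms can be concatenated. *)
Definition cyclic_chain (gT : finGroupType) (S : {set gT}) (H K : {group gT}) :=
  exists2 s : seq {group gT},
    all (fun M : {group gT} => M <| S) s &
    path (@cyclic_factor gT) H s && (last H s == K :> {set gT}).

Section CyclicChains.

Variable gT : finGroupType.
Implicit Types G H K L M N S : {group gT}.

Lemma cyclic_chain_refl (S : {set gT}) H : cyclic_chain S H H.
Proof. by exists [::]; rewrite /= ?eqxx. Qed.

Lemma cyclic_chain_trans (S : {set gT}) H K L :
  cyclic_chain S H K -> cyclic_chain S K L -> cyclic_chain S H L.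
Proof.
case=> s nS /andP[Ps /eqP/group_inj eK] [t nT /andP[Pt eL]].
exists (s ++ t); first by rewrite all_cat nS.
by rewrite cat_path last_cat Ps eK Pt eL.
Qed.

Lemma cyclic_chain_step (S : {set gT}) H K L :
  H \subset K -> cyclic (K / H) -> K <| S -> cyclic_chain S K L ->
  cyclic_chain S H L.
Proof.
move=> sHK cKH nK; apply: cyclic_chain_trans; exists [:: K]; first by rewrite /= nK.
by rewrite /= /cyclic_factor sHK cKH eqxx.
Qed.

End CyclicChains.

(** Serves to intersect a series with a subgroup, or to take its image or preimage: in each case one
    map [f] is applied termwise. *)
Lemma cyclic_chain_map (gT rT : finGroupType) (f : {group gT} -> {group rT})
    (S : {set gT}) (S' : {set rT}) (H K : {group gT}) :
  (forall M : {group gT}, M <| S -> f M <| S') ->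
  (forall M N : {group gT}, M <| S -> N <| S -> M \subset N -> cyclic (N / M) ->
    cyclic_factor (f M) (f N)) ->
  H <| S -> cyclic_chain S H K -> cyclic_chain S' (f H) (f K).
Proof.
move=> nf cf nH [s nS /andP[Ps /eqP/group_inj <-]].
elim: s H nH nS Ps => [|M s IHs] H nH /=; first by move=> *; apply: cyclic_chain_refl.
case/andP=> nM nS /andP[/andP[sHM cMH] Ps].
have /andP[sfHM cfMH] := cf _ _ nH nM sHM cMH.
exact: cyclic_chain_step sfHM cfMH (nf _ nM) (IHs _ nM nS Ps).
Qed.

Lemma cyclic_chain_ind (gT : finGroupType) (S : {set gT}) (P : {group gT} -> Prop)
    (H K : {group gT}) :
  (forall M N : {group gT}, M <| S -> N <| S -> M \subset N -> cyclic (N / M) -> P M -> P N) ->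
  H <| S -> cyclic_chain S H K -> P H -> P K.
Proof.
move=> stepP nH [s nS /andP[Ps /eqP/group_inj <-]].
elim: s H nH nS Ps => [|M s IHs] H nH //= /andP[nM nS] /andP[/andP[sHM cMH] Ps] PH.
by apply: IHs => //; apply: stepP PH.
Qed.

(** By the second isomorphism theorem the new factor embeds in [K / H]. *)
Lemma cyclic_factorI (gT : finGroupType) (H K M : {group gT}) : H <| K -> cyclic (K / H) ->
  cyclic_factor (H :&: M)%G (K :&: M)%G.
Proof.
move=> /andP[sHK nHK] cKH; rewrite /cyclic_factor /= setSI //=.
have nHKM: K :&: M \subset 'N(H) by rewrite subIset ?nHK.
rewrite -[H in H :&: M](setIidPl sHK) -setIA.
by rewrite (isog_cyclic (second_isog nHKM)) (cyclicS _ cKH) ?quotientS ?subsetIl.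
Qed.

Lemma supersolvable_chainI (gT : finGroupType) (S M : {group gT}) : supersolvable S -> M <| S ->
  cyclic_chain S 1%G M.
Proof.
move=> ssS nMS; pose f (H : {group gT}) := (H :&: M)%G.
have ->: 1%G = f 1%G by apply: val_inj; rewrite /= setI1g.
have {1}->: M = f S by apply: val_inj; rewrite /= (setIidPr (normal_sub nMS)).
apply: cyclic_chain_map ssS => [H nH | H K nH nK sHK|]; rewrite ?normalI ?normal1 //.
by apply: cyclic_factorI; apply: normalS nH; rewrite ?(normal_sub nK).
Qed.

Lemma morphim_supersolvable (gT rT : finGroupType) (D G : {group gT})
    (f : {morphism D >-> rT}) :
  G \subset D -> supersolvable G -> supersolvable (f @* G).
Proof.
move=> sGD ssG; pose F (H : {group gT}) := (f @* H)%G.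
have e1: 1%G = F 1%G by apply: val_inj; rewrite /= morphim1.
rewrite /supersolvable -/(cyclic_chain _ _ (F G)) e1.
apply: cyclic_chain_map ssG => [H nH | H K nH nK sHK cKH|]; rewrite ?morphim_normal ?normal1 //.
have nHK: H <| K by apply: normalS nH; rewrite ?(normal_sub nK).
rewrite /cyclic_factor /= morphimS //=.
have sKD := subset_trans (normal_sub nK) sGD.
have nHK' : (restrm sKD f) @* H = f @* H.
  by rewrite morphim_restrm (setIidPr sHK).
rewrite -nHK'; have <-: (restrm sKD f) @* K = f @* K by rewrite morphim_restrm setIid.
by rewrite -(morphim_quotm _ nHK) morphim_cyclic.
Qed.

(** Preimages of a series of [G / V] continue the series of [V]; the third isomorphism theorem
    preserves the factors. *)
Lemma supersolvable_quotient_ext (gT : finGroupType) (G V : {group gT}) :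
  V <| G -> cyclic_chain G 1%G V -> supersolvable (G / V) -> supersolvable G.
Proof.
move=> nVG c1 ssGV; apply: cyclic_chain_trans c1 _.
pose F (H : {group coset_of V}) := (coset V @*^-1 H)%G.
have eV: V = F 1%G by apply: val_inj; rewrite /= -kerE ker_coset.
have eG: G = F (G / V)%G by apply: val_inj; rewrite /= quotientGK.
have [sVG nV] := andP nVG.
rewrite {1}eV {2}eG; apply: cyclic_chain_map ssGV => [H nH | H K nH nK sHK cKH|];
  rewrite ?normal1 //.
  by rewrite eG /= morphpre_normal ?sub_im_coset // (subset_trans (normal_sub nH)) ?sub_im_coset.
have nHK: H <| K by apply: normalS nH; rewrite ?(normal_sub nK).
have nFHK: F H <| F K by rewrite /= morphpre_normal ?sub_im_coset.
have sVF L : V \subset F L by rewrite {1}eV /= morphpreS ?sub1G.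
have nVF L : V <| F L by rewrite /normal sVF /= subsetIl.
rewrite /cyclic_factor morphpreS //=.
by rewrite -(isog_cyclic (third_isog (sVF H) (nVF K) nFHK)) /= !cosetpreK.
Qed.

(** * Good actions by conjugation, and generation by centralizers *)

(** Goodness for two subgroups of one ambient group, with conjugation as the action, so that
    subgroups and quotients can be taken without building new actions. *)
Definition internally_good (gT : finGroupType) (A G : {set gT}) : Prop :=
  forall B H : {group gT}, B \subset A -> H \subset G -> B \subset 'N(H) ->
    [~: H, B] * 'C_H(B) = H.

Section InternallyGood.

Variable gT : finGroupType.
Implicit Types A B G H K N P V : {group gT}.

Lemma internally_goodS (A B G H : {set gT}) :
  B \subset A -> H \subset G -> internally_good A G -> internally_good B H.
Proof.
move=> sBA sHG gAG C K sCB sKH; apply: gAG; [exact: subset_trans sBA | exact: subset_trans sHG].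
Qed.

(** Goodness does the work usually done by coprimeness: if [C] is the preimage in [H] of the fixed
    points, then [[~: C, B]] lies in [N], so [C = [~: C, B] * 'C_C(B)] has the same image as
    ['C_C(B)]. *)
Lemma good_quotient_cent A G N B H :
  internally_good A G -> A \subset 'N(N) -> N \subset H -> B \subset A ->
  H \subset G -> H \subset 'N(N) -> B \subset 'N(H) ->
  'C_(H / N)(B / N) = 'C_H(B) / N.
Proof.
move=> gAG nNA sNH sBA sHG nNH nHB.
apply/eqP; rewrite eqEsubset quotient_subcent andbT.
have nNB := subset_trans sBA nNA.
pose C := (H :&: coset N @*^-1 'C(B / N))%G.
have sCH: C \subset H by apply: subsetIl.
have nNC := subset_trans sCH nNH.
have cCB: C / N \subset 'C(B / N) by rewrite (subset_trans (quotientS _ (subsetIr _ _))) ?cosetpreK.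
have nCB: B \subset 'N(C).
  rewrite normsI // (subset_trans _ (morphpre_norm _ _)) //.
  by rewrite -sub_quotient_pre // (subset_trans _ (norms_cent (normG _))).
have gC: [~: C, B] * 'C_C(B) = C by apply: gAG => //; apply: subset_trans sHG.
have sCBN: [~: C, B] \subset N by rewrite -quotient_cents2.
have ->: 'C_(H / N)(B / N) = C / N.
  apply/eqP; rewrite eqEsubset [X in _ && X]subsetI quotientS //= cCB !andbT.
  apply/subsetP=> _ /setIP[/morphimP[x nNx Hx ->] cx].
  by rewrite mem_quotient // inE Hx inE nNx inE.
rewrite -{1}gC quotientMl ?(subset_trans sCBN) ?normG //.
by rewrite (quotientS1 sCBN) mul1g quotientS // setSI.
Qed.

Lemma good_quotient A G N :
  internally_good A G -> A \subset 'N(N) -> N <| G ->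
  internally_good (A / N) (G / N).
Proof.
move=> gAG nNA /andP[sNG nNG] Bb Hb sBA sHG nHB.
pose B := (A :&: coset N @*^-1 Bb)%G; pose H := (coset N @*^-1 Hb)%G.
have eH: H / N = Hb by rewrite /= cosetpreK.
have eB: B / N = Bb.
  apply/eqP; rewrite eqEsubset; apply/andP; split.
    by rewrite (subset_trans (quotientS _ (subsetIr _ _))) ?cosetpreK.
  apply/subsetP=> xb Bx; have /morphimP[x nNx Ax def_x] := subsetP sBA _ Bx.
  by rewrite def_x mem_quotient // inE Ax inE nNx inE /= -def_x.
have sNH: N \subset H by apply: sub_cosetpre.
have sHG': H \subset G by rewrite -(quotientSGK _ sNG) ?eH //= subsetIl.
have nNB: B \subset 'N(N) by rewrite subIset ?nNA.
have nNH: H \subset 'N(N) by apply: subset_trans nNG.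
have nHB': B \subset 'N(H).
  by rewrite (subset_trans _ (morphpre_norm _ _)) // -sub_quotient_pre // eB.
have gH := gAG _ _ (subsetIl _ _ : B \subset A) sHG' nHB'.
apply/eqP; rewrite eqEsubset mul_subG ?commg_subl ?subsetIl //=.
rewrite -{1}eH -{1}gH quotientMl ?comm_subG // quotientR // eH eB.
by rewrite mulgS // -[in X in _ \subset X]eH -[in X in _ \subset X]eB quotient_subcent.
Qed.

(** The factorization of [P] gives [P, A] = [P, A, A], which in the [p]-group [P <*> A] forces
    [P, A] = 1. *)
Lemma good_pgroup_cent (p : nat) A G P :
  internally_good A G -> p.-group A -> P \subset G -> p.-group P ->
  A \subset 'N(P) -> A \subset 'C(P).
Proof.
move=> gAG pA sPG pP nPA; have gP := gAG _ _ (subxx A) sPG nPA.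
have sRA: [~: P, A] \subset [~: [~: P, A], A].
  rewrite -{1}gP commMG; last first.
    apply: normsR; last by rewrite cents_norm // subsetIr.
    by rewrite (subset_trans (subsetIl _ _)) ?commg_norml.
  have /commG1P->: 'C_P(A) \subset 'C(A) by apply: subsetIr.
  by rewrite mulg1.
rewrite centsC; apply/commG1P/eqP/idPn=> ntR.
have nilL: nilpotent (P <*> A).
  by apply: (pgroup_nil (p := p)); rewrite /= norm_joinEr // pgroupM pP.
have := nil_comm_properl nilL (_ : [~: P, A] \subset P <*> A) ntR.
move/(_ A); rewrite subsetI joing_subr commg_normr (subset_trans _ (joing_subl _ _)) ?commg_subl //.
by move=> /(_ isT isT); rewrite properE sRA andbF.
Qed.

End InternallyGood.

(* Induction on an A-chief factor G / N: it is an irreducible module for A, so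
   A acts on it through a cyclic quotient, by Schur's lemma. *)
Lemma gen_by_hyperplane_cents p (gT : finGroupType) (A G X : {group gT}) :
  internally_good A G -> p.-abelem A -> prime p -> solvable G -> A \subset 'N(G) ->
  (forall B : {group gT}, B \subset A -> #|A : B| %| p -> 'C_G(B) \subset X) ->
  G \subset X.
Proof.
move=> + abelA p_pr; have [n] := ubnP #|G|; elim: n G => // n IHn G leGn gAG solG nGA genX.
have [-> | ntG] := eqVneq (G : {set gT}) 1; first exact: sub1G.
have [N maxN]: {N : {group gT} | maxnormal N G (G <*> A)}.
  apply: ex_maxgroup; exists [1 gT]%G; rewrite proper1G ntG /=.
  by rewrite (subset_trans (subsetT _)) // norm1.
have [/andP[prNG nNGA] _] := maxgroupP maxN.
have [sNG _] := andP prNG; move: (nNGA); rewrite join_subG => /andP[nNG nNA].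
have sNX: N \subset X.
  apply: IHn (solvableS sNG solG) nNA _ => [||B sBA iB].
  - exact: leq_trans (proper_card prNG) leGn.
  - exact: internally_goodS gAG.
  - by apply: subset_trans (genX B sBA iB); rewrite setSI.
have minGN: minnormal (G / N) ((G <*> A) / N).
  by apply: maxnormal_minnormal; rewrite // join_subG normG.
have [_ ntGN /is_abelemP[r r_pr abelGN]] := minnormal_solvable minGN (subxx _) (quotient_sol N solG).
have abGN := abelem_abelian abelGN.
have nGNA : A / N \subset 'N(G / N) by rewrite quotient_norms.
(* The abelian group [G / N] normalizes all its subgroups, so minimality under [G <*> A] is
   minimality under [A]. *)
have minGNA: minnormal (G / N) (A / N).
  apply/mingroupP; split=> [|K /andP[ntK nKA] sKG]; first by rewrite ntGN.
  have [_ min] := mingroupP minGN; apply: min => //; rewrite ntK quotientY // join_subG nKA andbT.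
  by rewrite cents_norm // (subset_trans abGN) // centS.
(* [B] is the kernel of [A] on [G / N]; its index is the order of a group both cyclic and elementary
   abelian, hence 1 or [p]. *)
pose B := (A :&: coset N @*^-1 'C_(A / N)(G / N))%G.
have sBA: B \subset A by apply: subsetIl.
have eB: B / N = 'C_(A / N)(G / N).
  apply/eqP; rewrite eqEsubset; apply/andP; split.
    by rewrite (subset_trans (quotientS _ (subsetIr _ _))) ?cosetpreK.
  apply/subsetP=> xb Bx; have /setIP[/morphimP[x nNx Ax def_x] _] := Bx.
  by rewrite def_x mem_quotient // inE Ax inE nNx inE /= -def_x.
have iB: #|A : B| %| p.
  rewrite -(index_quotient_eq (H := N)) //; last first.
    by rewrite subsetI subsetIl (subset_trans (subsetIr _ _)) ?sub_cosetpre.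
  rewrite eB; set C := 'C_(A / N)(G / N).
  have nCA : A / N \subset 'N(C) by rewrite normsI ?normG ?norms_cent.
  have abelAN: p.-abelem (A / N / C) by rewrite !quotient_abelem.
  have cycAN: cyclic (A / N / C).
    pose rG := abelem_repr abelGN ntGN nGNA.
    have eC: C = rker rG by rewrite rker_abelem.
    rewrite eC; apply: mx_faithful_irr_abelian_cyclic (kquo_mx_faithful rG) _ _.
      by apply/quo_mx_irr; apply/abelem_mx_irrP.
    by rewrite -eC (abelem_abelian abelAN).
  rewrite -card_quotient //.
  have [->|nt] := eqVneq (A / N / C) 1; first by rewrite cards1 dvd1n.
  by rewrite (cyclic_abelem_prime abelAN cycAN nt).
have nGB := subset_trans sBA nGA.
(* Since [B] centralizes [G / N], goodness makes ['C_G(B)] cover [G / N]. *)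
have sGN: G / N \subset 'C_G(B) / N.
  rewrite -(good_quotient_cent gAG) // subsetI subxx /= centsC eB subsetIr //.
have := sGN; rewrite quotientSK // => /subset_trans; apply.
by rewrite mul_subG // genX.
Qed.

(** * Action on cyclic factors, and centralizers of noncyclic subgroups of [A] *)

Section CyclicAction.

Variables (gT : finGroupType) (C : {group gT}).
Hypothesis cycC : cyclic C.

(** Conjugation maps [G] into [Aut C], which is abelian. *)
Lemma der1_cent_cyclic (G : {group gT}) : G \subset 'N(C) -> G^`(1) \subset 'C(C).
Proof.
move=> nCG; have sG'G : G^`(1) \subset 'N(C) := subset_trans (der_sub 1 G) nCG.
rewrite -ker_conj_aut kerE -sub_morphim_pre // subG1 /= morphim_der // derg1.
apply/eqP/commG1P; rewrite -/(abelian _).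
exact: abelianS (Aut_conj_aut _ _) (Aut_cyclic_abelian cycC).
Qed.

Lemma expg_totient_cent_cyclic x : x \in 'N(C) -> x ^+ totient #|C| \in 'C(C).
Proof.
move=> nCx; rewrite -ker_conj_aut; apply/kerP; rewrite ?groupX // morphX //.
apply/eqP; rewrite -order_dvdn -card_Aut_cyclic // order_dvdG //.
exact: (subsetP (Aut_conj_aut C 'N(C))) (mem_morphim _ nCx nCx).
Qed.

End CyclicAction.

(** An element centralizing all factors of a series of [M] and of order coprime to that of [M]
    centralizes [M]; the proof climbs the series that [S] induces on [M]. *)
Lemma coprime_cent_cyclic_chain q (gT : finGroupType) (S M : {group gT}) (y : gT) :
  supersolvable S -> M <| S -> q.-group M -> solvable M -> y \in S -> q^'.-elt y ->
  (forall H K : {group gT}, H <| S -> K <| S -> H \subset K -> K \subset M ->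
     cyclic (K / H) -> [~: K, <[y]>] \subset H) ->
  y \in 'C(M).
Proof.
move=> ssS nMS qM solM Sy q'y facy.
pose P (K : {group gT}) := K \subset M -> <[y]> \subset 'C(K).
suffices: P M by rewrite /P subxx cycle_subG => ->.
apply: (@cyclic_chain_ind gT S P 1%G M _ (normal1 S) (supersolvable_chainI ssS nMS)); last first.
  by rewrite /P cents1.
move=> H K nHS nKS sHK cKH PH sKM.
have nKy: <[y]> \subset 'N(K) by rewrite cycle_subG (subsetP (normal_norm nKS)).
have nHy: <[y]> \subset 'N(H) by rewrite cycle_subG (subsetP (normal_norm nHS)).
have nHK: K \subset 'N(H) := subset_trans (normal_sub nKS) (normal_norm nHS).
have co: coprime #|K| #|<[y]>| by apply: pnat_coprime (pgroupS sKM qM) q'y.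
(* Coprime action: the fixed points on [K / H], here everything, lift to [K]. *)
have sKHC: K \subset H * 'C_K(<[y]>).
  rewrite -quotientSK // coprime_quotient_cent ?(solvableS sKM) // subsetI subxx /=.
  by rewrite quotient_cents2 // facy.
rewrite (subset_trans _ (centS sKHC)) // centM subsetI (PH (subset_trans sHK sKM)) /=.
by rewrite centsC subsetIr.
Qed.

Section NoncyclicCentralizer.

Variables (p q : nat) (gT : finGroupType) (A G V : {group gT}).
Hypotheses (p_pr : prime p) (q_pr : prime q) (abelA : p.-abelem A).
Hypothesis goodAG : internally_good A G.
Hypothesis ssCG : forall a, a \in A -> a != 1 -> supersolvable 'C_G[a].
Hypotheses (nVG : V <| G) (nVA : A \subset 'N(V)) (abelV : q.-abelem V).

Let qV : q.-group V := abelem_pgroup abelV.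
Let solV : solvable V := abelian_sol (abelem_abelian abelV).

(** [V] is generated by the ['C_V(B)] with [B] of index dividing [p] in [D]. As [#|D|] is at least
    [p ^ 2], each [B] contains some [a != 1], and ['C_V(B)] lies in a normal subgroup of the
    supersolvable group ['C_G[a]], which contains [y]. The last hypothesis is applied with [S] equal
    to ['C_G[a]]. *)
Lemma noncyclic_cent (D : {group gT}) (y : gT) :
    D \subset A -> p ^ 2 <= #|D| -> y \in 'C_G(D) -> q^'.-elt y ->
    (forall (S H K : {group gT}), 'C_G(D) \subset S -> H <| S -> K <| S ->
       H \subset K -> K \subset V -> cyclic (K / H) -> [~: K, <[y]>] \subset H) ->
  y \in 'C(V).
Proof.
move=> sDA leD /setIP[Gy cDy] q'y facy.
have abelD := abelemS sDA abelA.
rewrite -sub1set centsC; set X := 'C([set y]).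
apply: (@gen_by_hyperplane_cents p gT D V [group of X]) => // [||B sBD iB].
- exact: internally_goodS (normal_sub nVG) goodAG.
- exact: subset_trans nVA.
have ntB: B :!=: 1.
  apply: contraTneq leD => B1; rewrite -ltnNge B1 indexg1 in iB *.
  by rewrite (leq_ltn_trans (dvdn_leq (prime_gt0 p_pr) iB)) // -{1}(expn1 p) ltn_exp2l ?prime_gt1.
have [a Ba nta] := trivgPn _ ntB.
have Da := subsetP sBD a Ba; have Aa := subsetP sDA a Da.
pose S := 'C_G[a]%G; pose M := (V :&: S)%G.
have sCS: 'C_G(D) \subset S by rewrite /S /= setIS // -cent_set1 centS // sub1set.
have nMS: M <| S.
  by rewrite /normal subsetIr normsI ?normG // (subset_trans (subsetIl _ _)) ?normal_norm.
have sMV: M \subset V by apply: subsetIl.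
have cMy: y \in 'C(M).
  apply: (@coprime_cent_cyclic_chain q _ S) => //; first exact: ssCG.
  - exact: pgroupS qV.
  - exact: solvableS solV.
  - by apply: (subsetP sCS); rewrite inE Gy.
  - move=> H K nHS nKS sHK sKM cKH; apply: (facy S) => //.
    exact: subset_trans sMV.
rewrite centsC sub1set; apply: subsetP cMy; apply: centS.
have sCa: 'C(B) \subset 'C[a] by rewrite -cent_set1 centS ?sub1set.
by rewrite subsetI subsetIl setISS ?(normal_sub nVG).
Qed.

(** For [S] containing ['C_G(D)], [y] lies in the derived subgroup of [S], which centralizes every
    cyclic factor. *)
Lemma noncyclic_cent_der1 (D : {group gT}) (y : gT) :
    D \subset A -> p ^ 2 <= #|D| -> y \in 'C_G(D)^`(1) -> q^'.-elt y ->
  y \in 'C(V).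
Proof.
move=> sDA leD T'y q'y; apply: (@noncyclic_cent D) => //.
  exact: (subsetP (der_sub 1 _)) T'y.
move=> S H K sCS nHS nKS sHK sKV cKH.
have nHS' := normal_norm nHS; have sKS := normal_sub nKS.
have S'y: y \in S^`(1) := subsetP (dergS 1 sCS) _ T'y.
apply: subset_trans (_ : [~: K, S^`(1)] \subset H); first by rewrite commgS ?cycle_subG.
rewrite -quotient_cents2 ?(subset_trans sKS) ?(subset_trans (der_sub 1 S)) //.
rewrite centsC quotient_der // der1_cent_cyclic //.
by rewrite quotient_norms ?normal_norm.
Qed.

(** A nontrivial cyclic factor of the elementary abelian [V] has order [q], so its automorphism
    group has order [q.-1]. *)
Lemma noncyclic_cent_exp (D : {group gT}) (x : gT) :
    D \subset A -> p ^ 2 <= #|D| -> x \in 'C_G(D) -> q^'.-elt x ->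
  x ^+ q.-1 \in 'C(V).
Proof.
move=> sDA leD Tx q'x; apply: (@noncyclic_cent D) => //; rewrite ?groupX //.
  by apply: p_eltX.
move=> S H K sCS nHS nKS sHK sKV cKH.
have nHS' := normal_norm nHS; have sKS := normal_sub nKS.
have Sx := subsetP sCS _ Tx; have nHx := subsetP nHS' _ Sx.
have nHK := subset_trans sKS nHS'.
rewrite -quotient_cents2 ?cycle_subG ?groupX // centsC quotient_cycle ?groupX //.
rewrite cycle_subG morphX //=.
have nKx: coset H x \in 'N(K / H).
  by rewrite (subsetP (quotient_norms _ (normal_norm nKS))) ?mem_quotient.
have [->|ntKH] := eqVneq (K / H) 1; first by rewrite cent1T inE.
have abelKH: q.-abelem (K / H) by rewrite quotient_abelem // (abelemS sKV).
rewrite -(totient_prime q_pr) -(cyclic_abelem_prime abelKH cKH ntKH).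
exact: expg_totient_cent_cyclic.
Qed.

End NoncyclicCentralizer.

(** * Linear action on an elementary abelian normal subgroup, and the Fitting subgroup *)

(** Let [Q] be the preimage of the core and [S] a Sylow [q]-subgroup of [Q], so that [Q] is [C * S].
    The normal subgroup [V] of the [q]-group [S] meets ['Z(S)], and that intersection is centralized
    by [C] and [S]. So ['C_V(Q)] is nontrivial and invariant, hence all of [V], and [Q] lies in
    [C]. *)
Lemma pcore_quotient_cent_minnormal (q : nat) (gT : finGroupType) (A G V : {group gT}) :
  minnormal V (G <*> A) -> V \subset G -> q.-abelem V -> A \subset 'N(G) ->
  'O_q(G / 'C_G(V)) = 1.
Proof.
move=> minV sVG abelV nGA; have [/andP[ntV]] := mingroupP minV.
rewrite join_subG => /andP[nVG nVA] minV'.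
have [qV abV _] := and3P abelV.
set C := 'C_G(V); have nCG: G \subset 'N(C) by rewrite normsI ?normG ?norms_cent.
have nCA: A \subset 'N(C) by rewrite normsI ?norms_cent.
have sVC: V \subset C by rewrite subsetI sVG.
pose Q := (coset C @*^-1 'O_q(G / C))%G.
have eQ: Q / C = 'O_q(G / C) by rewrite /= cosetpreK.
have sQG: Q \subset G by rewrite -(quotientSGK _ (subsetIl _ _ : C \subset G)) ?eQ ?pcore_sub ?subsetIl.
have sCQ: C \subset Q by apply: sub_cosetpre.
have nQ (B : {group gT}) : B \subset 'N(C) -> B \subset 'N(G) -> B \subset 'N(Q).
  move=> nCB nGB; rewrite (subset_trans _ (morphpre_norm _ _)) // -sub_quotient_pre //.
  by rewrite gFnorm_trans // quotient_norms.
have [S sylS] := Sylow_exists q Q; have [sSQ qS _] := and3P sylS.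
have nCQ := subset_trans sQG nCG.
have sQCS: Q \subset C * S.
  have sylSC := quotient_pHall (subset_trans sSQ nCQ) sylS.
  have qQC: q.-group (Q / C) by rewrite eQ pcore_pgroup.
  by rewrite -quotientSK // (sub_pHall sylSC qQC) ?quotientS.
have sVS: V \subset S.
  have: V \subset 'O_q(Q).
    by rewrite pcore_max // /normal (subset_trans sVC) // (subset_trans sQG).
  by move/subset_trans; apply; apply: pcore_sub_Hall sylS.
have ntZ: V :&: 'Z(S) != 1.
  rewrite meet_center_nil ?(pgroup_nil qS) // /normal sVS.
  by rewrite (subset_trans sSQ) // (subset_trans sQG).
have sZ: V :&: 'Z(S) \subset 'C_V(Q).
  rewrite subsetI subsetIl (subset_trans _ (centS sQCS)) // centM subsetI.
  have cCV: V \subset 'C(C) by rewrite centsC subsetIr.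
  by rewrite (subset_trans (subsetIl _ _) cCV) (subset_trans (subsetIr _ _)) ?subsetIr.
have defV: 'C_V(Q) = V.
  apply: minV'; last exact: subsetIl.
  rewrite (subG1_contra sZ) //= join_subG !normsI ?norms_cent ?nQ ?normG //.
rewrite -eQ quotientS1 // subsetI sQG centsC /= -defV subsetIr //.
Qed.

Lemma minnormal_abelian_exp_cyclic (q : nat) (gT : finGroupType) (G W : {group gT}) :
  minnormal W G -> q.-abelem W -> prime q -> G^`(1) \subset 'C(W) ->
  (forall x, x \in G -> x ^+ q.-1 \in 'C(W)) -> cyclic W.
Proof.
move=> minW abelW q_pr cG' cGq; have [/andP[ntW nWG] _] := mingroupP minW.
pose rG := abelem_repr abelW ntW nWG.
have kG: rker rG = 'C_G(W) by rewrite rker_abelem.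
have irrG: mx_irreducible rG by apply/abelem_mx_irrP.
pose rGq := kquo_repr rG.
have irrGq: mx_irreducible rGq by apply/quo_mx_irr.
have abGq: abelian (G / rker rG).
  by rewrite sub_der1_abelian //= kG subsetI der_sub.
(* Cyclicity turns the bound on the exponent into the divisibility of the order needed for a root of
   unity. *)
have cycGq: cyclic (G / rker rG).
  exact: mx_faithful_irr_abelian_cyclic (kquo_mx_faithful rG) irrGq abGq.
have nkG: G \subset 'N(rker rG) := rker_norm rG.
have dvGq: #|G / rker rG| %| q.-1.
  have [xb defG] := cyclicP cycGq; rewrite defG -orderE order_dvdn.
  have /morphimP[x nx Gx ->]: xb \in G / rker rG by rewrite defG cycle_id.
  by rewrite -morphX //= coset_id // kG inE groupX ?cGq.
have [z prim_z] : exists z : 'F_q, (#|(G / rker rG)%g|.-primitive_root z)%R.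
  have q1_gt0: 0 < q.-1 by rewrite -subn1 subn_gt0 prime_gt1.
  (* The [q.-1] nonzero elements of ['F_q] are all roots of unity of that order, so one of them is
     primitive. *)
  pose rs := rem 0%R (enum 'F_q).
  have /hasP[z _ /dvdn_prim_root prim_z]: has (q.-1.-primitive_root)%R rs.
    apply: has_prim_root => //; rewrite ?rem_uniq ?enum_uniq //.
      apply/allP=> z; rewrite mem_rem_uniq ?enum_uniq // !inE => /andP[nz0 _].
      apply/unity_rootP/(mulfI nz0); rewrite -exprS prednK ?prime_gt0 // mulr1.
      by rewrite -{2}(expf_card z) card_Fp.
    by rewrite size_rem ?mem_enum // -cardE card_Fp.
  by exists (z ^+ (q.-1 %/ #|(G / rker rG)%g|))%R; apply: prim_z.
have splG := primitive_root_splitting_abelian prim_z abGq.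
(* 'F_q contains the exp(G / C_G(W))-th roots of unity, hence splits the module. *)
have dimW := mx_irr_abelian_linear splG irrGq abGq.
rewrite prime_cyclic // (card_pgroup (abelem_pgroup abelW)).
by rewrite -(dim_abelemE abelW ntW) dimW expn1.
Qed.

(** Every chief factor of [G] inside [V] is cyclic; the series is built upwards from [K], by
    induction on [#|V| - #|K|]. *)
Lemma abelian_exp_cyclic_chain (q : nat) (gT : finGroupType) (G V : {group gT}) :
  prime q -> V <| G -> q.-abelem V -> G^`(1) \subset 'C(V) ->
  (forall x, x \in G -> x ^+ q.-1 \in 'C(V)) -> cyclic_chain G 1%G V.
Proof.
move=> q_pr /andP[sVG nVG] abelV cG' cGq.
suffices chainV n (K : {group gT}) :
  #|V| - #|K| < n -> K \subset V -> K <| G -> cyclic_chain G K V.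
- exact: chainV (ltnSn _) (sub1G V) (normal1 G).
elim: n K => // n IHn K ltKn sKV nsKG; have nKG := normal_norm nsKG.
have nKV := subset_trans sVG nKG.
have [/eqP VK1 | ntVK] := eqVneq (V / K) 1.
  rewrite -subG1 quotient_sub1 // in VK1.
  have ->: V = K by apply/group_inj/eqP; rewrite eqEsubset VK1.
  exact: cyclic_chain_refl.
have [Wb minW sWV] := minnormal_exists ntVK (quotient_norms K nVG).
have cW := centS sWV; have [/andP[ntW nWG] _] := mingroupP minW.
have cycW: cyclic Wb.
  apply: minnormal_abelian_exp_cyclic minW (abelemS sWV (quotient_abelem _ abelV)) q_pr _ _.
    by rewrite -quotient_der // (subset_trans _ cW) // quotient_cents.
  move=> _ /morphimP[x Kx Gx ->]; rewrite -morphX //; apply: (subsetP cW).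
  by apply: (subsetP (quotient_cent _ _)); rewrite mem_quotient ?cGq.
pose W := (coset K @*^-1 Wb)%G.
have eW: W / K = Wb by rewrite /= cosetpreK.
have sWV': W \subset V by rewrite -(quotientSGK _ sKV) ?eW //= subsetIl.
have nsWG: W <| G.
  rewrite /normal (subset_trans sWV') //= (subset_trans _ (morphpre_norm _ _)) //.
  by rewrite -sub_quotient_pre.
have sKW : K \subset W by apply: sub_cosetpre.
apply: (cyclic_chain_step sKW _ nsWG); rewrite ?eW //; apply: IHn => //.
rewrite -ltnS (leq_trans _ ltKn) // ltnS ltn_sub2l //.
  rewrite proper_card // properE sKV; apply: contra ntVK => sVK.
  by rewrite -subG1 quotient_sub1.
rewrite proper_card // properE sKW; apply: contra ntW => sWK.
by rewrite -eW -subG1 quotient_sub1 // (subset_trans sWV').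
Qed.


Lemma solvable_cent_Fitting (gT : finGroupType) (G : {group gT}) :
  solvable G -> 'C_G('F(G)) \subset 'F(G).
Proof.
move=> solG; set D := 'C_G('F(G)); pose Z := (D :&: 'F(G))%G.
have nsDG: D <| G by rewrite /normal subsetIl normsI ?norms_cent ?gFnorm ?normG.
have nsZG: Z <| G by rewrite normalI // Fitting_normal.
have nZG := normal_norm nsZG; have nZD := subset_trans (normal_sub nsDG) nZG.
apply/idPn=> ntD.
have ntDZ: D / Z != 1.
  by rewrite -subG1 quotient_sub1 // subsetI subxx.
have solDZ: solvable (D / Z) by rewrite quotient_sol // (solvableS (subsetIl _ _)).
have [Mb [sMD nsMG ntM /is_abelemP[r r_pr /abelem_abelian abM]]] :=
  solvable_norm_abelem solDZ (quotient_normal Z nsDG) ntDZ.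
(* Z is central in M and M / Z is abelian, so M is a nilpotent normal subgroup. *)
pose M := (coset Z @*^-1 Mb)%G.
have eM: M / Z = Mb by rewrite /= cosetpreK.
have sMD': M \subset D by rewrite -(quotientSGK _ (subsetIl _ _ : Z \subset D)) ?eM //= subsetIl.
have nZM := subset_trans sMD' nZD.
have nsMG': M <| G.
  rewrite /normal (subset_trans sMD') ?(normal_sub nsDG) //=.
  by rewrite (subset_trans _ (morphpre_norm _ _)) // -sub_quotient_pre // normal_norm.
have M'Z: M^`(1) \subset 'Z(M).
  have sM'Z: M^`(1) \subset Z by rewrite der1_min // eM.
  rewrite subsetI der_sub (subset_trans sM'Z) // centsC.
  by rewrite (subset_trans sMD') // (subset_trans (subsetIr _ _)) // centS // subsetIr.
have nilM: nilpotent M by rewrite -quotient_center_nil abelian_nil // sub_der1_abelian.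
have sMF := Fitting_max nsMG' nilM.
case/negP: ntM; rewrite -eM -subG1 quotient_sub1 // subsetI sMD' //.
Qed.

(** * A cyclic series inside a minimal invariant normal subgroup *)

Section GoodOperator.

Variables (p : nat) (gT : finGroupType) (A G : {group gT}).
Hypotheses (p_pr : prime p) (solG : solvable G) (abelA : p.-abelem A).
Hypotheses (leA : p ^ 4 <= #|A|) (nGA : A \subset 'N(G)).
Hypothesis goodAG : internally_good A G.
Hypothesis ssCG : forall a, a \in A -> a != 1 -> supersolvable 'C_G[a].

(** From [#|B1| * #|B2| <= #|A| * #|B1 :&: B2|], the intersection has index at most [p ^ 2] in [A],
    and [#|A|] is at least [p ^ 4]. *)
Lemma card_hyperplaneI (B1 B2 : {group gT}) :
  B1 \subset A -> B2 \subset A -> #|A : B1| %| p -> #|A : B2| %| p ->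
  p ^ 2 <= #|B1 :&: B2|.
Proof.
have leB (B : {group gT}) : B \subset A -> #|A : B| %| p -> #|A| <= #|B| * p.
  by move=> sBA /(dvdn_leq (prime_gt0 p_pr)) iB; rewrite -(Lagrange sBA) leq_mul2l iB orbT.
move=> sB1 sB2 /(leB _ sB1) le1 /(leB _ sB2) le2.
have le12: #|B1| * #|B2| <= #|A| * #|B1 :&: B2|.
  by rewrite mul_cardG leq_mul2r subset_leq_card ?orbT // mul_subG.
have pp2: 0 < p ^ 2 by rewrite expn_gt0 prime_gt0.
have: #|A| * #|A| <= #|A| * (#|B1 :&: B2| * p ^ 2).
  rewrite (leq_trans (leq_mul le1 le2)) // mulnACA mulnn mulnA leq_mul2r le12 orbT //.
rewrite leq_pmul2l ?cardG_gt0 // => /(leq_trans leA).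
by rewrite (expnD p 2 2) leq_pmul2r.
Qed.

Variables (q : nat) (V : {group gT}).
Hypotheses (q_pr : prime q) (sVG : V \subset G) (abelV : q.-abelem V).
Hypothesis minV : minnormal V (G <*> A).

Let nVGA : G <*> A \subset 'N(V). Proof. by have [/andP[]] := mingroupP minV. Qed.
Let nVG : G \subset 'N(V). Proof. exact: subset_trans (joing_subl _ _) nVGA. Qed.
Let nVA : A \subset 'N(V). Proof. exact: subset_trans (joing_subr _ _) nVGA. Qed.
Let nsVG : V <| G. Proof. exact/andP. Qed.

Lemma minnormal_chain_char : q = p -> cyclic_chain G 1%G V.
Proof.
move=> eqp; have pV : p.-group V by rewrite -eqp; apply: abelem_pgroup abelV.
have cVA: A \subset 'C(V) := good_pgroup_cent goodAG (abelem_pgroup abelA) sVG pV nVA.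
(* Three subgroups lemma: [A, V, G] and [V, G, A] are trivial because [A] centralizes [V]. *)
have cVGA: [~: G, A] \subset 'C(V).
  apply/commG1P/three_subgroup; first by rewrite (commG1P cVA) comm1G.
  by apply/commG1P; rewrite (subset_trans _ (_ : V \subset 'C(A))) 1?centsC // commg_subl.
have [a Aa nta]: exists2 a, a \in A & a != 1.
  apply/trivgPn; rewrite trivg_card1 gtn_eqF // (leq_trans _ leA) //.
  by rewrite -{1}(expn0 p) ltn_exp2l ?prime_gt1.
pose S := 'C_G[a]%G.
have sCS: 'C_G(A) \subset S by rewrite /S /= setIS // -cent_set1 centS // sub1set.
have sVS: V \subset S by rewrite (subset_trans _ sCS) // subsetI sVG centsC.
have nsVS: V <| S by rewrite /normal sVS (subset_trans (subsetIl _ _)).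
(* Meeting each term with [V] makes visible that [[~: G, A]] centralizes it; ['C_G(A)] lies in [S]
   and normalizes it, so [G] does. *)
pose f (H : {group gT}) := (H :&: V)%G.
have e1: 1%G = f 1%G by apply: val_inj; rewrite /= setI1g.
have eV: V = f V by apply: val_inj; rewrite /= setIid.
rewrite e1 {1}eV.
apply: cyclic_chain_map (normal1 S) (supersolvable_chainI (ssCG Aa nta) nsVS).
  move=> H nHS; rewrite /normal (subset_trans (subsetIr _ _)) //=.
  rewrite -(goodAG (subxx A) (subxx G) nGA) mul_subG //.
    by rewrite cents_norm // (subset_trans cVGA) // centS // subsetIr.
  by rewrite (subset_trans sCS) // normsI ?normal_norm.
move=> H K nHS nKS sHK; apply: cyclic_factorI; apply: normalS nHS => //.
exact: normal_sub.
Qed.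

Lemma minnormal_chain_cross_char : q != p -> cyclic_chain G 1%G V.
Proof.
move=> neqp; set C := 'C_G(V).
have sCG: C \subset G by apply: subsetIl.
have nCG: G \subset 'N(C) by rewrite normsI ?normG ?norms_cent.
have nCA: A \subset 'N(C) by rewrite normsI ?norms_cent.
have Oq1: 'O_q(G / C) = 1 := pcore_quotient_cent_minnormal minV sVG abelV nGA.
set H := (G / C)%G; set F := 'F(H).
have q'F: q^'.-group F.
  have /dprodP[_ defF _ _] := nilpotent_pcoreC q (Fitting_nil H).
  by rewrite /F /= -defF p_core_Fitting Oq1 mul1g pcore_pgroup.
have nsFH: F <| H := Fitting_normal H.
pose E := (coset C @*^-1 F)%G.
have eE: E / C = F by rewrite /= cosetpreK.
have sEG: E \subset G by rewrite -(quotientSGK _ sCG) ?eE ?(normal_sub nsFH) //= subsetIl.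
have nEA: A \subset 'N(E).
  rewrite (subset_trans _ (morphpre_norm _ _)) // -sub_quotient_pre //.
  by rewrite gFnorm_trans // quotient_norms.
have goodAE : internally_good A E by apply: internally_goodS goodAG.
(* A [q^']-element of [G / C] is the image of the [q^']-part of any preimage, so it suffices to test
   elements of [G] of order prime to [q]. *)
have coset_q'1 y : y \in G -> q^'.-elt (coset C y) -> y.`_q^' \in 'C(V) -> coset C y = 1.
  move=> Gy q'y cy; rewrite -(constt_p_elt q'y) -morph_constt ?(subsetP nCG) //.
  by rewrite /= coset_id // inE cy groupX.
(* Both [f] and [g] centralize [B1 :&: B2], so their commutator lies in the derived subgroup of its
   centralizer, and its image lies in the [q^']-group [F]. *)
have comm_hyp (B1 B2 : {group gT}) f g :
    B1 \subset A -> B2 \subset A -> #|A : B1| %| p -> #|A : B2| %| p ->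
    f \in 'C_E(B1) -> g \in 'C_G(B2) -> commute (coset C f) (coset C g).
  move=> sB1 sB2 i1 i2 /setIP[Ef cf] /setIP[Gg cg].
  have Gf := subsetP sEG f Ef.
  have [nCf nCg] := (subsetP nCG f Gf, subsetP nCG g Gg).
  apply/commgP; rewrite -morphR //; apply/eqP/coset_q'1; first by rewrite groupR.
    apply: mem_p_elt q'F _; rewrite morphR // /F.
    have Ff: coset C f \in F by rewrite -eE mem_quotient.
    rewrite (subsetP (_ : [~: F, H] \subset F)) ?mem_commg ?mem_quotient //.
    by rewrite commg_subl normal_norm.
  have sD: B1 :&: B2 \subset A by rewrite subIset ?sB1.
  apply: (noncyclic_cent_der1 p_pr abelA goodAG ssCG nsVG nVA abelV sD).
  - exact: card_hyperplaneI.
  - apply: groupX; apply: mem_commg; rewrite inE ?Gf ?Gg /=.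
      exact: (subsetP (centS (subsetIl _ _))) cf.
    exact: (subsetP (centS (subsetIr _ _))) cg.
  - exact: p_elt_constt.
(* Generation by centralizers is used twice, for [E] and then for [G]. *)
have cFH: F \subset 'C(H).
  rewrite -eE (sub_quotient_pre _ (subset_trans sEG nCG)).
  apply: (gen_by_hyperplane_cents goodAE abelA p_pr (solvableS sEG solG) nEA) => B1 sB1 i1.
  apply/subsetP=> f CEf; have Gf := subsetP sEG f (subsetP (subsetIl _ _) f CEf).
  rewrite inE (subsetP nCG) // inE /=.
  suffices: G \subset coset C @*^-1 'C[coset C f].
    by rewrite -sub_quotient_pre // -cent_set1 centsC sub1set.
  apply: (gen_by_hyperplane_cents goodAG abelA p_pr solG nGA) => B2 sB2 i2.
  apply/subsetP=> g CGg; have Gg := subsetP (subsetIl _ _) g CGg.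
  rewrite inE (subsetP nCG) // inE; apply/cent1P/commute_sym.
  exact: comm_hyp CEf CGg.
have solH: solvable H := quotient_sol C solG.
have sHF: H \subset F.
  by rewrite (subset_trans _ (solvable_cent_Fitting solH)) // subsetI subxx centsC.
have abH: abelian H by rewrite /abelian (subset_trans sHF).
have q'H: q^'.-group H := pgroupS sHF q'F.
apply: (abelian_exp_cyclic_chain q_pr nsVG abelV) => [|x Gx].
  by apply: subset_trans (der1_min nCG abH) (subsetIr _ _).
(* In the abelian group [H] the elements of order dividing [q.-1] form a subgroup, so only the
   generating centralizers need checking. *)
have: G \subset coset C @*^-1 (group (group_Ldiv q.-1 abH)).
  apply: (gen_by_hyperplane_cents goodAG abelA p_pr solG nGA) => B sB iB.
  apply/subsetP=> g CGg; have Gg := subsetP (subsetIl _ _) g CGg.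
  have nCg := subsetP nCG g Gg.
  rewrite inE nCg inE /= inE mem_quotient // inE.
  have q'g : q^'.-elt (coset C g) by apply: mem_p_elt q'H _; rewrite mem_quotient.
  rewrite -(constt_p_elt q'g) -morph_constt // -morphX ?groupX //=.
  rewrite coset_id //; apply/setIP; split; first by rewrite !groupX.
  apply: (noncyclic_cent_exp p_pr q_pr abelA goodAG ssCG nsVG nVA abelV sB).
  - by have := card_hyperplaneI sB sB iB iB; rewrite setIid.
  - exact: groupX.
  - exact: p_elt_constt.
move/subsetP/(_ x Gx)/morphpreP=> [nCx]; rewrite !inE /= => /andP[_ /eqP xq1].
have: x ^+ q.-1 \in C by rewrite coset_idr ?groupX ?morphX.
by case/setIP.
Qed.

End GoodOperator.

(** * Induction on the order of [G], and transfer to abstract actions *)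

(** The condition [G :&: A = 1] makes [A] isomorphic to [A / V], so the bound on [#|A|] survives in
    the quotient. *)
Theorem internally_good_supersolvable p (gT : finGroupType) (A G : {group gT}) :
  prime p -> solvable G -> p.-abelem A -> p ^ 4 <= #|A| -> A \subset 'N(G) ->
  G :&: A = 1 -> internally_good A G ->
  (forall a, a \in A -> a != 1 -> supersolvable 'C_G[a]) -> supersolvable G.
Proof.
move=> p_pr; have [n] := ubnP #|G|; elim: n gT A G => // n IHn gT A G.
move=> leGn solG abelA leA nGA tiGA goodAG ssCG.
have [G1 | ntG] := eqVneq (G : {set gT}) 1.
  rewrite (group_inj (G1 : G = 1%G :> {set gT})).
  exact: (cyclic_chain_refl _ 1%G).
have nGGA: G <*> A \subset 'N(G) by rewrite join_subG normG.
have [V minV sVG] := minnormal_exists ntG nGGA.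
have [nVGA ntV /is_abelemP[q q_pr abelV]] := minnormal_solvable minV sVG solG.
have nVG := subset_trans (joing_subl _ _) nVGA.
have nVA := subset_trans (joing_subr _ _) nVGA.
have nsVG: V <| G by apply/andP.
apply: (supersolvable_quotient_ext nsVG).
  have [eqp | neqp] := eqVneq q p; first exact: (minnormal_chain_char p_pr abelA leA nGA goodAG ssCG sVG abelV minV eqp).
  exact: (minnormal_chain_cross_char p_pr solG abelA leA nGA goodAG ssCG q_pr sVG abelV minV neqp).
have isoA: A \isog A / V.
  by apply: quotient_isog => //; apply/trivgP; rewrite -tiGA setSI.
apply: (IHn _ (A / V)%G); rewrite ?quotient_sol ?quotient_abelem ?quotient_norms //.
- exact: leq_trans (ltn_quotient ntV sVG) leGn.
- by rewrite -(card_isog isoA).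
- by rewrite -quotientGI // tiGA quotient1.
- exact: good_quotient.
move=> _ /morphimP[a nVa Aa ->] nta.
have sa: <[a]> \subset A by rewrite cycle_subG.
(* By goodness the centralizer in the quotient is the image of a supersolvable one. *)
have ->: 'C_(G / V)[coset V a] = 'C_G[a] / V.
  rewrite -!cent_cycle -quotient_cycle //; apply: good_quotient_cent goodAG _ _ _ _ _ _ => //.
  exact: subset_trans nGA.
apply: morphim_supersolvable; first by rewrite subIset ?nVG.
by apply: ssCG => //; apply: contraNneq nta => ->; rewrite morph1.
Qed.

(** In the semidirect product the action becomes conjugation: both subgroups are pulled back,
    factorized there, and the factors mapped forward. *)
Lemma good_action_sdpair (aT rT : finGroupType) (A : {group aT}) (G : {group rT})
    (to : groupAction A G) :
  good_action to -> internally_good (sdpair2 to @* A) (sdpair1 to @* G).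
Proof.
move=> goodto B' H' sBA sHG nHB.
pose B := (sdpair2 to @*^-1 B')%G; pose H := (sdpair1 to @*^-1 H')%G.
have eB: sdpair2 to @* B = B' by apply: morphpreK.
have eH: sdpair1 to @* H = H' by apply: morphpreK.
have sB: B \subset A by apply: subsetIl.
have sH: H \subset G by apply: subsetIl.
have actsB: [acts B, on H | to] by rewrite actsEsd // eB eH.
have defH := goodto B H sB sH actsB.
apply/eqP; rewrite eqEsubset mul_subG ?commg_subl ?subsetIl //=.
rewrite -{1}eH defH morphimMl; last first.
  rewrite gen_subG; apply/subsetP=> _ /imset2P[x b Hx Bb ->].
  by rewrite groupM ?groupV ?gact_stable ?(subsetP sH) ?(subsetP sB).
rewrite mulgSS //.
  rewrite morphim_gen ?gen_subG; last first.
    apply/subsetP=> _ /imset2P[x b Hx Bb ->].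
    by rewrite groupM ?groupV ?gact_stable ?(subsetP sH) ?(subsetP sB).
  apply/subsetP=> _ /morphimP[_ _ /imset2P[x b Hx Bb ->] ->].
  have [Gx Ab] := (subsetP sH x Hx, subsetP sB b Bb).
  (* The image of [x^-1 * to x b] is the commutator of the images of [x] and [b]. *)
  rewrite morphM ?groupV ?gact_stable // morphV //= sdpair_act //.
  by rewrite mem_commg // -?eH -?eB mem_morphim.
rewrite gacentEsd eB subsetI.
apply/andP; split; first by rewrite -eH morphimS ?subsetIl.
by rewrite sub_morphim_pre ?subsetIr // (subset_trans (subsetIl _ _)).
Qed.

Theorem theoremB (p : nat) (aT rT : finGroupType) (A : {group aT}) (G : {group rT})
  (to : groupAction A G) :
  prime p -> solvable G -> p.-abelem A -> (p ^ 4 <= #|A|)%N ->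
  good_action to ->
  (forall a, a \in A -> a != 1 -> supersolvable 'C_(G | to)[a]) ->
  supersolvable G.
Proof.
move=> p_pr solG abelA leA goodto ssCG.
have inj1 := injm_sdpair1 to; have inj2 := injm_sdpair2 to.
(* [G] is a homomorphic image of its copy in the semidirect product, so supersolvability comes back
   along the inverse embedding. *)
have defG: invm inj1 @* (sdpair1 to @* G) = G by rewrite morphim_invm.
rewrite -defG; apply: morphim_supersolvable => //.
apply: (@internally_good_supersolvable p _ (sdpair2 to @* A)%G (sdpair1 to @* G)%G) => //.
- exact: morphim_sol.
- exact: morphim_abelem.
- by rewrite card_injm.
- exact: im_sdpair_norm.
- exact: im_sdpair_TI.
- exact: good_action_sdpair.
move=> _ /morphimP[a _ Aa ->] nta.
have ->: 'C_(sdpair1 to @* G)[sdpair2 to a] = sdpair1 to @* 'C_(G | to)[a].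
  by rewrite gacentEsd morphim_set1 // cent_set1 morphim_setIpre.
apply: morphim_supersolvable; first exact: subsetIl.
by apply: ssCG => //; apply: contraNneq nta => ->; rewrite morph1.
Qed.
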